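(* Let $(M,A,g,F)$ be an almost Hermitian manifold with K\''ahler 2-form $F$, considered as a generalized Riemannian manifold $(M,G=g+F)$. Then there is a linear connection $\nabla$ on $(M,G)$ satisfying the Einstein metricity condition with totally skew-symmetric torsion $T$ if and only if $(M,A,g,F)$ is a Nearly K\''ahler manifold. The skew-symmetric torsion is determined by $$T(X,Y,Z)=-\tfrac13dF(X,Y,Z)=\tfrac14N(X,Y,AZ).$$ The connection is unique and given by $$g(\nabla_XY,Z)=g(\nabla^g_XY,Z)-\tfrac16dF(X,Y,Z)=g(\nabla^g_XY,Z)+\tfrac18N(X,Y,AZ).$$ The Einstein metricity condition has the form $(\nabla_XG)(Y,Z)=\frac13\big[dF(X,Y,Z)-dF(X,Y,AZ)\big]$. The covariant derivatives of $g$ and of the K\''ahler form $F$ are $$(\nabla_Xg)(Y,Z)=0,\qquad (\nabla_XF)(Y,Z)=\tfrac13\big[dF(X,Y,Z)-dF(X,Y,AZ)\big].$$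
   Context: An almost Hermitian manifold $(M,g,A)$ is a Riemannian manifold of dimension $2m\ge 4$ with an endomorphism field $A$ satisfying $A^2=-I$ and $g(AX,AY)=g(X,Y)$; its K\''ahler form is $F(X,Y)=g(AX,Y)$. Let $\nabla^g$ be the Levi-Civita connection of $g$. The manifold is Nearly K\''ahler if $(\nabla^g_XA)X=0$ for all $X$ (equivalently $(\nabla^g_XF)(X,Y)=0$). The torsion of $\nabla$ is $T(X,Y)=\nabla_XY-\nabla_YX-[X,Y]$, with $T(X,Y,Z)=g(T(X,Y),Z)$; it is totally skew-symmetric if $T(X,Y,Z)=-T(X,Z,Y)$. For $G=g+F$, a linear connection $\nabla$ satisfies the Einstein metricity condition if $XG(Y,Z)-G(\nabla_YX,Z)-G(Y,\nabla_XZ)=0$ for commuting vector fields $X,Y,Z$, equivalently $(\nabla_XG)(Y,Z)=-G(T(X,Y),Z)$. The Nijenhuis tensor of $A$ is $N(X,Y)=[AX,AY]+A^2[X,Y]-A[AX,Y]-A[X,AY]$, with $N(X,Y,Z)=g(N(X,Y),Z)$. The exterior derivative is normalized so that for commuting vector fields $dF(X,Y,Z)=XF(Y,Z)+YF(Z,X)+ZF(X,Y)$. Tensor identities hold for all vector fields $X,Y,Z$. *)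

(* Defs.v *)
From HB Require Import structures.
From mathcomp Require Import all_boot all_order all_algebra.
From mathcomp Require Import ring.
From mathcomp Require Import all_classical all_reals.
From mathcomp Require Import topology normedtype derive.

Set Implicit Arguments.
Unset Strict Implicit.
Unset Printing Implicit Defensive.

Import Order.TTheory GRing.Theory Num.Theory.
Import numFieldNormedType.Exports.

Local Open Scope classical_set_scope.
Local Open Scope ring_scope.

Section Smooth.
Variables (R : realType) (n : nat).
Implicit Types (U : set 'rV[R]_n) (f g : 'rV[R]_n -> R).

(* Meant for open U: the partial derivatives up to order k exist and are
   continuous at every point of U. *)
Fixpoint Ck_on (k : nat) U f : Prop :=
  (forall x, U x -> {for x, continuous f}) /\
  if k is k'.+1 then
    forall i : 'I_n,
      (forall x, U x -> derivable f x (delta_mx 0 i)) /\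
      Ck_on k' U ('D_(delta_mx 0 i) f)
  else True.

Definition smooth_on U f := forall k, Ck_on k U f.

Lemma Ck_onW k U f : Ck_on k.+1 U f -> Ck_on k U f.
Proof.
elim: k f => [|k IHk] f [fc fd]; split=> // i.
by have [fi /IHk] := fd i.
Qed.

Lemma Ck_on_ext k U f g : open U -> (forall x, U x -> f x = g x) ->
  Ck_on k U f -> Ck_on k U g.
Proof.
move=> oU; elim: k f g => [|k IHk] f g fg [fc fd].
  split=> // x Ux; have near_fg : \near x, f x = g x.
    by apply: filterS (open_nbhs_nbhs (conj oU Ux)) => y /fg.
  rewrite /prop_for /continuous_at -(fg _ Ux).
  exact: cvg_trans (near_eq_cvg near_fg) (fc _ Ux).
have near_fg x : U x -> \near x, f x = g x.
  by move=> Ux; apply: filterS (open_nbhs_nbhs (conj oU Ux)) => y /fg.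
split=> [x Ux|i].
  rewrite /prop_for /continuous_at -(fg _ Ux).
  exact: cvg_trans (near_eq_cvg (near_fg _ Ux)) (fc _ Ux).
have [fi fk] := fd i; split=> [x Ux|].
  exact: near_eq_derivable (near_fg _ Ux) (fi _ Ux).
apply: IHk fk => x Ux.
exact: near_eq_derive (near_fg _ Ux).
Qed.

Lemma Ck_on_cst k U (c : R) : open U -> Ck_on k U (cst c).
Proof.
move=> oU; elim: k c => [|k IHk] c; split=> [x _|] //; first exact: cst_continuous.
  exact: cst_continuous.
move=> i; split=> [x _|]; first exact: derivable_cst.
by apply: (Ck_on_ext oU _ (IHk 0)) => x _; rewrite derive_cst.
Qed.

Lemma Ck_onD k U f g : open U -> Ck_on k U f -> Ck_on k U g -> Ck_on k U (f + g).
Proof.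
move=> oU; elim: k f g => [|k IHk] f g [fc fd] [gc gd].
  by split=> // x Ux; exact: (continuousD (fc _ Ux) (gc _ Ux)).
split=> [x Ux|i]; first exact: (continuousD (fc _ Ux) (gc _ Ux)).
have [fi fk] := fd i; have [gi gk] := gd i.
split=> [x Ux|]; first exact: derivableD (fi _ Ux) (gi _ Ux).
apply: (Ck_on_ext oU _ (IHk _ _ fk gk)) => x Ux.
by rewrite deriveD//; [exact: fi|exact: gi].
Qed.

Lemma Ck_onM k U f g : open U -> Ck_on k U f -> Ck_on k U g -> Ck_on k U (f * g).
Proof.
move=> oU; elim: k f g => [|k IHk] f g fk gk.
  have [fc _] := fk; have [gc _] := gk.
  by split=> // x Ux; exact: (continuousM (fc _ Ux) (gc _ Ux)).
have fk' := Ck_onW fk; have gk' := Ck_onW gk.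
have [fc fd] := fk; have [gc gd] := gk; split=> [x Ux|i].
  exact: (continuousM (fc _ Ux) (gc _ Ux)).
have [fi fik] := fd i; have [gi gik] := gd i.
split=> [x Ux|]; first exact: derivableM (fi _ Ux) (gi _ Ux).
apply: (Ck_on_ext oU _ (Ck_onD oU (IHk _ _ fk' gik) (IHk _ _ gk' fik))) => x Ux.
by rewrite deriveM//; [exact: fi|exact: gi].
Qed.

End Smooth.

Record chart (R : realType) (n : nat) (M : topologicalType) := Chart {
  chart_dom : set M;
  chart_cod : set 'rV[R]_n;
  chart_map : M -> 'rV[R]_n;
  chart_inv : 'rV[R]_n -> M;
  chart_dom_open : open chart_dom;
  chart_cod_open : open chart_cod;
  chart_map_cod : forall p, chart_dom p -> chart_cod (chart_map p);
  chart_inv_dom : forall x, chart_cod x -> chart_dom (chart_inv x);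
  chart_mapK : forall p, chart_dom p -> chart_inv (chart_map p) = p;
  chart_invK : forall x, chart_cod x -> chart_map (chart_inv x) = x;
  chart_map_cont : forall p, chart_dom p -> {for p, continuous chart_map};
  chart_inv_cont : forall x, chart_cod x -> {for x, continuous chart_inv} }.

Record manifold (R : realType) (n : nat) := Manifold {
  mfd_sort :> topologicalType;
  mfd_hausdorff : hausdorff_space mfd_sort;
  mfd_second_countable : @second_countable mfd_sort;
  atlas : set (chart R n mfd_sort);
  atlas_cover : forall p, exists2 c, atlas c & chart_dom c p;
  atlas_smooth : forall c c', atlas c -> atlas c' -> forall j : 'I_n,
    smooth_on (chart_cod c `&` chart_inv c @^-1` chart_dom c')
              (fun x => chart_map c' (chart_inv c x) 0 j) }.

Section SmoothFunctions.
Variables (R : realType) (n : nat) (M : manifold R n).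

Definition smooth (f : M -> R) : Prop :=
  forall c, atlas c -> smooth_on (chart_cod c) (f \o chart_inv c).

Definition smooth_pred : {pred M -> R} := [pred f | `[< smooth f >]].

Lemma smooth_cst (a : R) : smooth (cst a).
Proof. by move=> c _ k; apply: Ck_on_cst; exact: chart_cod_open. Qed.

Lemma smoothD f g : smooth f -> smooth g -> smooth (f + g).
Proof.
move=> fs gs c ac k; have oc := @chart_cod_open _ _ _ c.
exact: (Ck_onD oc (fs c ac k) (gs c ac k)).
Qed.

Lemma smoothM f g : smooth f -> smooth g -> smooth (f * g).
Proof.
move=> fs gs c ac k; have oc := @chart_cod_open _ _ _ c.
exact: (Ck_onM oc (fs c ac k) (gs c ac k)).
Qed.

Lemma smooth_subring_closed : subring_closed smooth_pred.
Proof.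
split=> [|f g /asboolP fs /asboolP gs|f g /asboolP fs /asboolP gs].
- by apply/asboolP; exact: smooth_cst.
- apply/asboolP; have -> : f - g = f + cst (-1) * g.
    by apply/funext => x; rewrite !fctE mulN1r.
  by apply: smoothD => //; apply: smoothM => //; exact: smooth_cst.
- by apply/asboolP; exact: smoothM.
Qed.

Record smoothFun := SmoothFun {
  smooth_fun :> M -> R;
  smooth_funP : smooth_fun \in smooth_pred }.

HB.instance Definition _ := [isSub for smooth_fun].
HB.instance Definition _ := [Choice of smoothFun by <:].
HB.instance Definition _ := GRing.SubChoice_isSubComPzRing.Build _ smooth_pred
  smoothFun smooth_subring_closed.

Lemma smoothZ_subproof (a : R) (f : smoothFun) : cst a * f \in smooth_pred.
Proof. by apply/asboolP/(smoothM (smooth_cst a))/asboolP/smooth_funP. Qed.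

Definition smooth_scale a f := SmoothFun (smoothZ_subproof a f).

Lemma smooth_scaleA a b f :
  smooth_scale a (smooth_scale b f) = smooth_scale (a * b) f.
Proof. by apply/val_inj/funext => p; exact: mulrA. Qed.

Lemma smooth_scale1 : left_id 1 smooth_scale.
Proof. by move=> f; apply/val_inj/funext => p; exact: mul1r. Qed.

Lemma smooth_scaleDr : right_distributive smooth_scale +%R.
Proof. by move=> a f g; apply/val_inj/funext => p; exact: mulrDr. Qed.

Lemma smooth_scaleDl f : {morph smooth_scale^~ f : a b / a + b}.
Proof. by move=> a b; apply/val_inj/funext => p; exact: mulrDl. Qed.

HB.instance Definition _ := GRing.Zmodule_isLmodule.Build R smoothFun
  smooth_scaleA smooth_scale1 smooth_scaleDr smooth_scaleDl.

End SmoothFunctions.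

Notation "'C^oo' M" := (smoothFun M) (at level 10, M at level 8).

Section VectorFields.
Variables (R : realType) (n : nat) (M : manifold R n).

Definition derivation (D : C^oo M -> C^oo M) : Prop :=
  (forall (a : R) f h, D (a *: f + h) = a *: D f + D h) /\
  (forall f h, D (f * h) = D f * h + f * D h).

(* The value at p of a vector field X is the tangent vector f |-> X f p. *)
Record vectorField := VectorField {
  vf_fun :> C^oo M -> C^oo M;
  vf_funP : derivation vf_fun }.

Lemma vectorField_eq (X Y : vectorField) : (forall f, X f = Y f) -> X = Y.
Proof.
case: X Y => [X XP] [Y YP] /= /funext XY; move: XP; rewrite XY => XP.
by congr VectorField; exact: Prop_irrelevance.
Qed.

HB.instance Definition _ := gen_eqMixin vectorField.
HB.instance Definition _ := gen_choiceMixin vectorField.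

Lemma smooth_scaleAl (a : R) (f h : C^oo M) : a *: (f * h) = (a *: f) * h.
Proof. by apply/val_inj/funext => p /=; exact: mulrA. Qed.

Lemma smooth_scaleAr (a : R) (f h : C^oo M) : a *: (f * h) = f * (a *: h).
Proof. by rewrite mulrC smooth_scaleAl mulrC. Qed.

Lemma derivation0 : derivation (fun=> 0).
Proof.
by split=> [a f h|f h]; rewrite ?scaler0 ?addr0 // mul0r mulr0 addr0.
Qed.

Lemma derivationN (X : vectorField) : derivation (fun f => - X f).
Proof.
have [XL XM] := vf_funP X; split=> [a f h|f h].
  by rewrite XL opprD scalerN.
by rewrite XM opprD mulNr mulrN.
Qed.

Lemma derivationD (X Y : vectorField) : derivation (fun f => X f + Y f).
Proof.
have [XL XM] := vf_funP X; have [YL YM] := vf_funP Y; split=> [a f h|f h].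
  by rewrite XL YL scalerDr addrACA.
by rewrite XM YM mulrDl mulrDr addrACA.
Qed.

Lemma derivationZ (u : C^oo M) (X : vectorField) : derivation (fun f => u * X f).
Proof.
have [XL XM] := vf_funP X; split=> [a f h|f h].
  by rewrite XL mulrDr smooth_scaleAr.
by rewrite XM mulrDr mulrA mulrCA.
Qed.

Definition vf_zero := VectorField derivation0.
Definition vf_opp X := VectorField (derivationN X).
Definition vf_add X Y := VectorField (derivationD X Y).
Definition vf_scale u X := VectorField (derivationZ u X).

Lemma vf_addA : associative vf_add.
Proof. by move=> X Y Z; apply: vectorField_eq => f /=; rewrite addrA. Qed.
Lemma vf_addC : commutative vf_add.
Proof. by move=> X Y; apply: vectorField_eq => f /=; rewrite addrC. Qed.
Lemma vf_add0 : left_id vf_zero vf_add.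
Proof. by move=> X; apply: vectorField_eq => f /=; rewrite add0r. Qed.
Lemma vf_addN : left_inverse vf_zero vf_opp vf_add.
Proof. by move=> X; apply: vectorField_eq => f /=; rewrite addNr. Qed.

HB.instance Definition _ :=
  GRing.isZmodule.Build vectorField vf_addA vf_addC vf_add0 vf_addN.

Lemma vf_scaleA u v X : vf_scale u (vf_scale v X) = vf_scale (u * v) X.
Proof. by apply: vectorField_eq => f /=; rewrite mulrA. Qed.
Lemma vf_scale1 : left_id 1 vf_scale.
Proof. by move=> X; apply: vectorField_eq => f /=; rewrite mul1r. Qed.
Lemma vf_scaleDr : right_distributive vf_scale +%R.
Proof. by move=> u X Y; apply: vectorField_eq => f /=; rewrite mulrDr. Qed.
Lemma vf_scaleDl X : {morph vf_scale^~ X : u v / u + v}.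
Proof. by move=> u v; apply: vectorField_eq => f /=; rewrite mulrDl. Qed.

HB.instance Definition _ := GRing.Zmodule_isLmodule.Build (C^oo M) vectorField
  vf_scaleA vf_scale1 vf_scaleDr vf_scaleDl.

Lemma derivation_bracket (X Y : vectorField) :
  derivation (fun f => X (Y f) - Y (X f)).
Proof.
have [XL XM] := vf_funP X; have [YL YM] := vf_funP Y; split=> [a f h|f h].
  by rewrite YL XL XL YL scalerBr opprD addrACA.
have XD u v : X (u + v) = X u + X v by rewrite -[u]scale1r XL !scale1r.
have YD u v : Y (u + v) = Y u + Y v by rewrite -[u]scale1r YL !scale1r.
rewrite YM XM XD YD !XM !YM mulrBl mulrBr.
by apply/val_inj/funext => p /=; rewrite !fctE; ring.
Qed.

Definition bracket X Y := VectorField (derivation_bracket X Y).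

End VectorFields.

Notation "''VF' M" := (vectorField M) (at level 10, M at level 8).

(* Tensor fields are maps on vector fields that are multilinear over the ring of
   smooth functions. *)
Section Tensors.
Variables (R : realType) (n : nat) (M : manifold R n).
Implicit Types (X Y Z : 'VF M) (B : 'VF M -> 'VF M -> C^oo M).

Record metric := Metric {
  metric_fun :> 'VF M -> 'VF M -> C^oo M;
  metric_linearl : forall u X Y Z,
    metric_fun (u *: X + Y) Z = u * metric_fun X Z + metric_fun Y Z;
  metric_sym : forall X Y, metric_fun X Y = metric_fun Y X;
  metric_pos : forall X (p : M), (exists f : C^oo M, X f p <> 0) ->
    0 < metric_fun X X p }.

(* R-linearity in the second argument is conn_addr together with conn_leibniz at
   constant functions. *)
Record connection := Connection {
  conn_fun :> 'VF M -> 'VF M -> 'VF M;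
  conn_linearl : forall u X Y Z,
    conn_fun (u *: X + Y) Z = u *: conn_fun X Z + conn_fun Y Z;
  conn_addr : forall X Y Z, conn_fun X (Y + Z) = conn_fun X Y + conn_fun X Z;
  conn_leibniz : forall X u Y,
    conn_fun X (u *: Y) = X u *: Y + u *: conn_fun X Y }.

Definition torsion (D : connection) X Y := D X Y - D Y X - bracket X Y.

Definition torsion3 (g : metric) (D : connection) X Y Z := g (torsion D X Y) Z.

Definition cov_bil (D : connection) B X Y Z :=
  X (B Y Z) - B (D X Y) Z - B Y (D X Z).

Definition cov_endo (D : connection) (A : 'VF M -> 'VF M) X Y :=
  D X (A Y) - A (D X Y).

Definition levi_civita (g : metric) (D : connection) :=
  (forall X Y, torsion D X Y = 0) /\ (forall X Y Z, cov_bil D g X Y Z = 0).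

Definition skew_torsion (g : metric) (D : connection) :=
  forall X Y Z, torsion3 g D X Y Z = - torsion3 g D X Z Y.

(* For a 2-form B, without the factor 1/3. *)
Definition ext_d B X Y Z :=
  X (B Y Z) + Y (B Z X) + Z (B X Y)
  - B (bracket X Y) Z - B (bracket Y Z) X - B (bracket Z X) Y.

Definition almost_hermitian (g : metric) (A : 'VF M -> 'VF M) :=
  (forall X, A (A X) = - X) /\ (forall X Y, g (A X) (A Y) = g X Y).

Definition kahler_form (g : metric) (A : 'VF M -> 'VF M) X Y := g (A X) Y.

Definition gen_metric (g : metric) (A : 'VF M -> 'VF M) X Y :=
  g X Y + kahler_form g A X Y.

Definition nearly_kahler (Dg : connection) (A : 'VF M -> 'VF M) :=
  forall X, cov_endo Dg A X X = 0.

Definition nijenhuis (A : 'VF M -> 'VF M) X Y :=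
  bracket (A X) (A Y) + A (A (bracket X Y))
  - A (bracket (A X) Y) - A (bracket X (A Y)).

Definition nijenhuis3 (g : metric) (A : 'VF M -> 'VF M) X Y Z :=
  g (nijenhuis A X Y) Z.

(* The tensorial form of the condition
   X (G Y Z) - G (D Y X) Z - G Y (D X Z) = 0 on commuting fields;
   see einstein_commuting. *)
Definition einstein_metricity (G : 'VF M -> 'VF M -> C^oo M) (D : connection) :=
  forall X Y Z, cov_bil D G X Y Z = - G (torsion D X Y) Z.

Lemma einstein_commuting (g : metric) (A : {linear 'VF M -> 'VF M})
    (D : connection) X Y Z (G := gen_metric g A) : bracket X Y = 0 ->
  cov_bil D G X Y Z = - G (torsion D X Y) Z <->
  X (G Y Z) - G (D Y X) Z - G Y (D X Z) = 0.
Proof.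
move=> XY0.
have gD U V W : g (U + V) W = g U W + g V W.
  by rewrite -[U]scale1r metric_linearl mul1r scale1r.
have GB U V W : G (U - V) W = G U W - G V W.
  have GD U' V' : G (U' + V') W = G U' W + G V' W.
    by rewrite /G /gen_metric /kahler_form raddfD !gD addrACA.
  by apply/eqP; rewrite eq_sym subr_eq -GD subrK.
rewrite /cov_bil /torsion XY0 subr0 GB opprB.
set a := X _; set b := G (D X Y) Z; set c := G Y _; set d := G (D Y X) Z.
have <- : a - b - c - (d - b) = a - d - c.
  by rewrite opprB addrA [a - b - c]addrAC subrK addrAC.
by split=> [->|/eqP]; [rewrite subrr | rewrite subr_eq0 => /eqP].
Qed.

End Tensors.

(* Main.v *)
Require Import Defs.
From HB Require Import structures.
From mathcomp Require Import all_boot all_order all_algebra.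
From mathcomp Require Import lra.
From mathcomp Require Import all_classical all_reals.
From mathcomp Require Import topology normedtype derive.

Set Implicit Arguments.
Unset Strict Implicit.
Unset Printing Implicit Defensive.

Import Order.TTheory GRing.Theory Num.Theory.

Local Open Scope ring_scope.

(** Write [T(X,Y,Z)] for the torsion of [D], a 3-form when it is totally skew,
and [(D_X A)Y] for [cov_endo D A X Y].

Splitting the Einstein condition [D G = - G(T,.)] into its parts symmetric and
skew in [Y, Z], with [T] skew, expresses both derivatives by the torsion:
[[
  (D_X g)(Y,Z) = (T(X,Y,AZ) + T(X,Z,AY)) / 2,
  (D_X F)(Y,Z) = - T(X,Y,Z) + (T(X,Y,AZ) - T(X,Z,AY)) / 2.
]]
These are not independent, because [D_X A] anticommutes with [A].  Inserting
them into that relation leaves exactly [T(X,AY,Z) = T(X,Y,AZ)]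
([torsion3_A_shift]): [A] may be moved between any two slots of the torsion.
The first formula then says [D g = 0] ([einstein_metric_parallel]), and the
second one says [(D_X F)(Y,Z) = T(X,Y,AZ) - T(X,Y,Z)].  Expanding [dF] and the
Nijenhuis tensor through [D] gives [dF = - 3 T] and [N(X,Y,Z) = - 4 T(X,Y,AZ)].
A metric connection with skew torsion is [Dg + T/2], by the argument of the
Koszul formula ([metric_connection_skew_torsion]).  Since [T] is a multiple of
[dF], this makes [D] unique; and the same relation gives
[g((Dg_X A)Y,Z) = - T(X,Y,Z)], which is skew in [X, Y], so the manifold is
nearly Kaehler.

Conversely, that last formula dictates the connection on a nearly Kaehler
manifold: [D_X Y = Dg_X Y - (Dg_X A)Y / 2] ([nk_connection]).  Its torsion is
[- (Dg_X A)Y], and the Einstein condition is a direct check.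

Vector fields with the same products with all vector fields are equal
([metric_nondegenerate]), so the identities above can be stated between smooth
functions; at a point they become linear relations between real numbers. *)

(** * Pointwise computation with smooth functions and vector fields *)

Section Pointwise.
Variables (R : realType) (n : nat) (M : manifold R n).
Implicit Types (f h : C^oo M) (X Y : 'VF M) (p : M).

Lemma smoothP f h : (forall p, f p = h p) -> f = h.
Proof. by move=> fh; apply/val_inj/funext. Qed.

Lemma smooth_at p f h : f = h -> f p = h p.
Proof. by move->. Qed.

Lemma smooth0E p : (0 : C^oo M) p = 0. Proof. by []. Qed.
Lemma smoothDE f h p : (f + h) p = f p + h p. Proof. by []. Qed.
Lemma smoothNE f p : (- f) p = - f p. Proof. by []. Qed.
Lemma smoothZE (a : R) f p : (a *: f) p = a * f p. Proof. by []. Qed.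

Definition smoothE := (smooth0E, smoothDE, smoothNE, smoothZE).

(** Vector fields form a module over the smooth functions, so a real factor in
front of one has to be the constant function [a *: 1]; through the metric it
becomes a real factor again. *)
Lemma smooth_scale_mul1 (a : R) f : (a *: (1 : C^oo M)) * f = a *: f.
Proof. by rewrite -smooth_scaleAl mul1r. Qed.

Lemma vectorFieldP X Y : (forall f p, X f p = Y f p) -> X = Y.
Proof. by move=> XY; apply: vectorField_eq => f; exact: smoothP. Qed.

Lemma vfDE X Y f : (X + Y) f = X f + Y f. Proof. by []. Qed.
Lemma vfNE X f : (- X) f = - X f. Proof. by []. Qed.
Definition vfE := (vfDE, vfNE).

Lemma vf_derivD X f h : X (f + h) = X f + X h.
Proof. by have [XL _] := vf_funP X; rewrite -[f]scale1r XL !scale1r. Qed.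

Lemma vf_deriv0 X : X 0 = 0.
Proof. by apply: (addrI (X 0)); rewrite -vf_derivD !addr0. Qed.

Lemma vf_derivN X f : X (- f) = - X f.
Proof. by apply/eqP; rewrite -addr_eq0 -vf_derivD addNr vf_deriv0. Qed.

Lemma bracketC X Y : bracket X Y = - bracket Y X.
Proof. by apply: vectorField_eq => f /=; rewrite opprB. Qed.

End Pointwise.

(** * Nondegeneracy of the metric *)

Section MetricTheory.
Variables (R : realType) (n : nat) (M : manifold R n) (g : metric M).
Implicit Types (X Y Z : 'VF M).

Lemma metricDl X Y Z : g (X + Y) Z = g X Z + g Y Z.
Proof. by rewrite -[X]scale1r metric_linearl mul1r scale1r. Qed.

Lemma metric0l Z : g 0 Z = 0.
Proof. by apply: (addrI (g 0 Z)); rewrite -metricDl !addr0. Qed.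

Lemma metricNl X Z : g (- X) Z = - g X Z.
Proof. by apply/eqP; rewrite -addr_eq0 -metricDl addNr metric0l. Qed.

Lemma metricZl u X Z : g (u *: X) Z = u * g X Z.
Proof. by rewrite -[u *: X]addr0 metric_linearl metric0l addr0. Qed.

Lemma metricDr X Y Z : g Z (X + Y) = g Z X + g Z Y.
Proof. by rewrite Defs.metric_sym metricDl !(Defs.metric_sym _ Z). Qed.

Lemma metricNr X Z : g Z (- X) = - g Z X.
Proof. by rewrite Defs.metric_sym metricNl (Defs.metric_sym _ Z). Qed.

Definition metricE := (metricDl, metricNl, metricDr, metricNr).

(** If [X - Y] were nonzero at some point, positivity there would contradict
[g (X - Y) (X - Y) = 0]. *)
Lemma metric_nondegenerate X Y : (forall Z, g X Z = g Y Z) -> X = Y.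
Proof.
move=> gXY; apply/eqP; rewrite -subr_eq0; apply/eqP.
have gXX0 : g (X - Y) (X - Y) = 0 by rewrite metricDl metricNl gXY subrr.
apply: vectorFieldP => f p.
apply: contrapT => XYfp.
have : 0 < g (X - Y) (X - Y) p by apply: metric_pos; exists f.
by rewrite gXX0 smooth0E ltxx.
Qed.

End MetricTheory.

(** * Exterior derivative and Nijenhuis tensor for a connection with torsion *)

Section ConnectionTheory.
Variables (R : realType) (n : nat) (M : manifold R n).
Variables (g : metric M) (D : connection M) (A : {linear 'VF M -> 'VF M}).
Implicit Types (X Y Z : 'VF M).

Lemma conn0r X : D X 0 = 0.
Proof. by apply: (addrI (D X 0)); rewrite -conn_addr !addr0. Qed.

Lemma connNr X Y : D X (- Y) = - D X Y.
Proof. by apply/eqP; rewrite -addr_eq0 -conn_addr addNr conn0r. Qed.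

Lemma torsionC X Y : torsion D X Y = - torsion D Y X.
Proof. by rewrite /torsion (bracketC X) opprK !opprB addrC. Qed.

Lemma bracket_torsion X Y : bracket X Y = D X Y - D Y X - torsion D X Y.
Proof. by rewrite /torsion subKr. Qed.

Lemma torsion3C X Y Z : torsion3 g D X Y Z = - torsion3 g D Y X Z.
Proof. by rewrite /torsion3 torsionC metricNl. Qed.

Lemma cov_bil_gen_metric X Y Z : cov_bil D (gen_metric g A) X Y Z =
  cov_bil D g X Y Z + cov_bil D (kahler_form g A) X Y Z.
Proof.
apply: smoothP => p; rewrite /cov_bil /gen_metric vf_derivD !smoothE; lra.
Qed.

Lemma cov_metricC X Y Z : cov_bil D g X Y Z = cov_bil D g X Z Y.
Proof.
rewrite /cov_bil (Defs.metric_sym _ Y) (Defs.metric_sym _ (D X Y)).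
by rewrite (Defs.metric_sym _ Y) addrAC.
Qed.

(** Differentiating the defining relation [F(Y,Z) = g(AY,Z)]. *)
Lemma cov_kahler_endo X Y Z : cov_bil D (kahler_form g A) X Y Z =
  cov_bil D g X (A Y) Z + g (cov_endo D A X Y) Z.
Proof.
apply: smoothP => p.
rewrite /cov_bil /kahler_form /cov_endo !metricE !smoothE; lra.
Qed.

Lemma cov_endoDl X Y Z :
  cov_endo D A (X + Y) Z = cov_endo D A X Z + cov_endo D A Y Z.
Proof.
have DD V : D (X + Y) V = D X V + D Y V.
  by rewrite -[X]scale1r conn_linearl !scale1r.
by rewrite /cov_endo !DD linearD opprD addrACA.
Qed.

(** With [cov_endo_addr] and [cov_endo_scaler]: [D A] is a tensor.  In the
second argument the two derivative terms of the Leibniz rule cancel because [A]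
is linear over functions. *)
Lemma cov_endo_linearl u X Y Z :
  cov_endo D A (u *: X + Y) Z = u *: cov_endo D A X Z + cov_endo D A Y Z.
Proof. by rewrite /cov_endo !conn_linearl linearP opprD scalerBr addrACA. Qed.

Lemma cov_endo_addr X Y Z :
  cov_endo D A X (Y + Z) = cov_endo D A X Y + cov_endo D A X Z.
Proof. by rewrite /cov_endo linearD !conn_addr linearD opprD addrACA. Qed.

Lemma cov_endo_scaler X u Y :
  cov_endo D A X (u *: Y) = u *: cov_endo D A X Y.
Proof.
rewrite /cov_endo linearZ /= !conn_leibniz linearD !linearZ /= opprD addrACA.
by rewrite subrr add0r scalerBr.
Qed.

(** Replacing each bracket by [D_X Y - D_Y X - T(X,Y)] turns the six terms of
the exterior derivative into covariant derivatives, up to the torsion. *)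
Lemma ext_d_torsion (B : 'VF M -> 'VF M -> C^oo M) :
  (forall X Y Z, B (X + Y) Z = B X Z + B Y Z) ->
  (forall X Y, B X Y = - B Y X) ->
  forall X Y Z, ext_d B X Y Z =
    cov_bil D B X Y Z + cov_bil D B Y Z X + cov_bil D B Z X Y
    + B (torsion D X Y) Z + B (torsion D Y Z) X + B (torsion D Z X) Y.
Proof.
move=> BD BC X Y Z.
have B0 V : B 0 V = 0 by apply: (addrI (B 0 V)); rewrite -BD !addr0.
have BN U V : B (- U) V = - B U V.
  by apply/eqP; rewrite -addr_eq0 -BD addNr B0.
rewrite /ext_d /cov_bil !bracket_torsion !(BD, BN).
rewrite (BC Y (D X Z)) (BC Z (D Y X)) (BC X (D Z Y)).
apply: smoothP => p; rewrite !smoothE; lra.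
Qed.

(** The same substitution in the Nijenhuis tensor: each [D_V (A W)] combines
with a term [A (D_V W)] into a derivative of [A]. *)
Lemma nijenhuis_torsion X Y : nijenhuis A X Y =
  cov_endo D A (A X) Y - cov_endo D A (A Y) X
  - A (cov_endo D A X Y) + A (cov_endo D A Y X)
  - torsion D (A X) (A Y) - A (A (torsion D X Y))
  + A (torsion D (A X) Y) + A (torsion D X (A Y)).
Proof.
have AD U V : A (U + V) = A U + A V by rewrite linearD.
have AN U : A (- U) = - A U by rewrite linearN.
rewrite /nijenhuis !bracket_torsion /cov_endo.
rewrite !(AD, AN); apply: vectorFieldP => f p.
rewrite !vfE !smoothE; lra.
Qed.

End ConnectionTheory.

(** * The Einstein condition on an almost Hermitian manifold *)

Lemma cov_bil_skew (R : realType) (n : nat) (M : manifold R n)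
    (D : connection M) (B : 'VF M -> 'VF M -> C^oo M) :
  (forall X Y, B X Y = - B Y X) ->
  forall X Y Z, cov_bil D B X Y Z = - cov_bil D B X Z Y.
Proof.
move=> BC X Y Z; rewrite /cov_bil (BC Z Y) vf_derivN (BC (D X Z)) (BC Z).
apply: smoothP => p; rewrite !smoothE; lra.
Qed.

Section AlmostHermitian.
Variables (R : realType) (n : nat) (M : manifold R n).
Variables (g : metric M) (A : {linear 'VF M -> 'VF M}).
Hypothesis gA : almost_hermitian g A.
Implicit Types (D : connection M) (X Y Z : 'VF M).

Let AA X : A (A X) = - X. Proof. by have [->] := gA. Qed.

Lemma hermitian_skew X Y : g (A X) Y = - g X (A Y).
Proof. by have [_ gAA] := gA; rewrite -gAA AA metricNl. Qed.

Lemma kahler_formC X Y : kahler_form g A X Y = - kahler_form g A Y X.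
Proof. by rewrite /kahler_form hermitian_skew Defs.metric_sym. Qed.

(** Derivative of [A (A Y) = - Y]. *)
Lemma cov_endo_anticomm D X Y :
  cov_endo D A X (A Y) = - A (cov_endo D A X Y).
Proof. by rewrite /cov_endo AA connNr linearB /= AA opprB. Qed.

(** For a metric connection the derivative of [A] corresponds to that of the
2-form [F]. *)
Lemma cov_endo_skew D : (forall X Y Z, cov_bil D g X Y Z = 0) ->
  forall X Y Z, g (cov_endo D A X Y) Z = - g (cov_endo D A X Z) Y.
Proof.
move=> Dg0 X Y Z; have := cov_bil_skew D kahler_formC X Y Z.
by rewrite !cov_kahler_endo !Dg0 !add0r.
Qed.

Section Admissible.
Variable D : connection M.
Hypothesis einsteinD : einstein_metricity (gen_metric g A) D.
Hypothesis skewD : skew_torsion g D.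
Local Notation T := (torsion3 g D).

Lemma torsion3_AA X Y Z : T X Y (A (A Z)) = - T X Y Z.
Proof. by rewrite AA /torsion3 metricNr. Qed.

(* Metric duality turns G(T(X,Y),Z) into T(X,Y,Z) - T(X,Y,AZ). *)
Let einstein_torsion3 X Y Z :
  cov_bil D g X Y Z + cov_bil D (kahler_form g A) X Y Z
    = T X Y (A Z) - T X Y Z.
Proof.
rewrite -cov_bil_gen_metric einsteinD /gen_metric /kahler_form hermitian_skew.
by rewrite opprB.
Qed.

(** The part symmetric in [Y, Z] of the Einstein condition. *)
Lemma einstein_cov_metric X Y Z :
  cov_bil D g X Y Z = (2^-1 : R) *: (T X Y (A Z) + T X Z (A Y)).
Proof.
apply: smoothP => p.
have := smooth_at p (einstein_torsion3 X Y Z).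
have := smooth_at p (einstein_torsion3 X Z Y).
have := smooth_at p (cov_metricC g D X Y Z).
have := smooth_at p (cov_bil_skew D kahler_formC X Y Z).
have := smooth_at p (skewD X Y Z).
rewrite !smoothE; lra.
Qed.

(** The crux.  By [einstein_cov_metric] and [cov_kahler_endo], the torsion
determines [D A]; the identity is what remains of the requirement that [D_X A]
anticommute with [A]. *)
Lemma torsion3_A_shift X Y Z : T X (A Y) Z = T X Y (A Z).
Proof.
apply: smoothP => p.
(* The anticommutation, read through the metric; the Einstein condition at
   (AY, Z) and at (Y, AZ) evaluates its two sides. *)
have AP : g (cov_endo D A X (A Y)) Z = g (cov_endo D A X Y) (A Z).
  by rewrite cov_endo_anticomm metricNl hermitian_skew opprK.
have := smooth_at p AP.
have := smooth_at p (einstein_torsion3 X (A Y) Z).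
have := smooth_at p (einstein_torsion3 X Y (A Z)).
rewrite !cov_kahler_endo !einstein_cov_metric !AA.
have TN U V : T X U (- V) = - T X U V by rewrite /torsion3 metricNr.
have TNm U V : T X (- U) V = - T X U V by rewrite skewD TN -skewD.
have AN U : A (- U) = - A U by rewrite linearN.
rewrite !(AN, TN, TNm).
have := smooth_at p (skewD X Y Z).
have := smooth_at p (skewD X (A Y) Z).
have := smooth_at p (skewD X Y (A Z)).
have := smooth_at p (skewD X (A Y) (A Z)).
rewrite !smoothE; lra.
Qed.

(** In [einstein_cov_metric] the two terms cancel once [A] can change slot. *)
Lemma einstein_metric_parallel X Y Z : cov_bil D g X Y Z = 0.
Proof.
rewrite einstein_cov_metric -(torsion3_A_shift X Z) (skewD X Y).
by rewrite addNr scaler0.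
Qed.

Lemma einstein_cov_kahler X Y Z :
  cov_bil D (kahler_form g A) X Y Z = T X Y (A Z) - T X Y Z.
Proof. by rewrite -einstein_torsion3 einstein_metric_parallel add0r. Qed.

Lemma einstein_cov_endo X Y Z :
  g (cov_endo D A X Y) Z = T X Y (A Z) - T X Y Z.
Proof.
by rewrite -einstein_cov_kahler cov_kahler_endo einstein_metric_parallel add0r.
Qed.

(** Each cyclic term contributes [T(X,Y,AZ) - T(X,Y,Z)] from [D F] and
[- T(X,Y,AZ)] from [F(T(X,Y),Z)]. *)
Lemma einstein_ext_d X Y Z :
  ext_d (kahler_form g A) X Y Z = - (3 : R) *: T X Y Z.
Proof.
have FD U V W : kahler_form g A (U + V) W
    = kahler_form g A U W + kahler_form g A V W.
  by rewrite /kahler_form linearD metricDl.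
rewrite (ext_d_torsion D FD kahler_formC) !einstein_cov_kahler /kahler_form.
rewrite !hermitian_skew -!/(torsion3 g D _ _ _).
apply: smoothP => p.
have cyc U V W : T U V W = T V W U.
  by rewrite skewD torsion3C skewD !opprK -torsion3C.
have := smooth_at p (cyc X Y Z); have := smooth_at p (cyc Y Z X).
rewrite !smoothE; lra.
Qed.

(** The four terms in [D A] give [- 4 T(X,Y,AZ) - 4 T(X,Y,Z)] and the four
torsion terms give [4 T(X,Y,Z)]. *)
Lemma einstein_nijenhuis X Y Z :
  nijenhuis3 g A X Y Z = - (4 : R) *: T X Y (A Z).
Proof.
(* Rewriting directly with additivity of g would also unfold the derivatives
   and torsions, which are themselves differences. *)
have expand a b c d e f h k : g (a - b - c + d - e - f + h + k) Z =
    g a Z - g b Z - g c Z + g d Z - g e Z - g f Z + g h Z + g k Z.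
  by rewrite !metricE.
rewrite /nijenhuis3 (nijenhuis_torsion D) AA expand !hermitian_skew metricNl.
rewrite !einstein_cov_endo -!/(torsion3 g D _ _ _).
have shiftl U V W : T (A U) V W = T U V (A W).
  by rewrite torsion3C torsion3_A_shift -torsion3C.
rewrite !(shiftl, torsion3_A_shift, torsion3_AA).
rewrite !(torsion3C g D Y X).
apply: smoothP => p; rewrite !smoothE; lra.
Qed.

End Admissible.
End AlmostHermitian.

(** * Metric connections with skew torsion *)

Section LeviCivita.
Variables (R : realType) (n : nat) (M : manifold R n) (g : metric M).
Variables (Dg D : connection M).
Hypothesis LC : levi_civita g Dg.
Hypothesis parallelD : forall X Y Z, cov_bil D g X Y Z = 0.
Hypothesis skewD : skew_torsion g D.

(** The difference [Q(X,Y,Z) = g(D_X Y - Dg_X Y, Z)] is skew in [Y, Z] because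
both connections are metric, and [Q(X,Y,Z) - Q(Y,X,Z) = T(X,Y,Z)].  These
conditions determine [Q] from [T], and [T/2] satisfies them. *)
Lemma metric_connection_skew_torsion X Y Z :
  g (D X Y) Z = g (Dg X Y) Z + (2^-1 : R) *: torsion3 g D X Y Z.
Proof.
have [Tg0 Dgg0] := LC.
have compat U V W : g (D U V) W + g V (D U W) = g (Dg U V) W + g V (Dg U W).
  have := Dgg0 U V W; have := parallelD U V W; rewrite /cov_bil.
  move=> e e'; apply: smoothP => p; have := smooth_at p e.
  have := smooth_at p e'; rewrite !smoothE; lra.
have tors U V W : torsion3 g D U V W
    = g (D U V) W - g (D V U) W - g (Dg U V) W + g (Dg V U) W.
  have := Tg0 U V; rewrite /torsion3 /torsion => /eqP.
  rewrite subr_eq0 => /eqP <-.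
  by rewrite !metricE opprB addrA addrAC.
have sk := skewD.
have C (E : connection M) U V W : g U (E V W) = g (E V W) U.
  by rewrite Defs.metric_sym.
apply: smoothP => p.
have := smooth_at p (compat X Y Z); have := smooth_at p (compat Y X Z).
have := smooth_at p (compat Z X Y).
have := smooth_at p (sk X Y Z); have := smooth_at p (sk Y X Z).
have := smooth_at p (sk Z X Y).
rewrite !tors !C !smoothE; lra.
Qed.

End LeviCivita.

(** * The connection of a nearly Kaehler manifold *)

Section NearlyKahlerConnection.
Variables (R : realType) (n : nat) (M : manifold R n).
Variables (g : metric M) (A : {linear 'VF M -> 'VF M}) (Dg : connection M).
Implicit Types (X Y Z : 'VF M).

Let half : C^oo M := (2^-1 : R) *: (1 : C^oo M).

Let nk_fun X Y := Dg X Y - half *: cov_endo Dg A X Y.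

Let nk_linearl u X Y Z : nk_fun (u *: X + Y) Z = u *: nk_fun X Z + nk_fun Y Z.
Proof.
rewrite /nk_fun conn_linearl cov_endo_linearl scalerDr scalerA mulrC -scalerA.
by rewrite opprD addrACA (scalerBr u).
Qed.

Let nk_addr X Y Z : nk_fun X (Y + Z) = nk_fun X Y + nk_fun X Z.
Proof. by rewrite /nk_fun conn_addr cov_endo_addr scalerDr opprD addrACA. Qed.

Let nk_leibniz X u Y : nk_fun X (u *: Y) = X u *: Y + u *: nk_fun X Y.
Proof.
rewrite /nk_fun conn_leibniz cov_endo_scaler scalerA mulrC -scalerA.
by rewrite -addrA -scalerBr.
Qed.

(** [Dg + T/2] for [T(X,Y) = - (Dg_X A)Y]; see [einstein_nearly_kahler] for why
the torsion has to be this one. *)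
Definition nk_connection := Connection nk_linearl nk_addr nk_leibniz.

Lemma metric_nk_connection X Y Z :
  g (nk_connection X Y) Z
    = g (Dg X Y) Z - (2^-1 : R) *: g (cov_endo Dg A X Y) Z.
Proof.
by rewrite /= /nk_fun metricDl metricNl metricZl smooth_scale_mul1.
Qed.

Hypothesis gA : almost_hermitian g A.
Hypothesis LC : levi_civita g Dg.
Hypothesis NK : nearly_kahler Dg A.

(** Polarization. *)
Lemma nearly_kahler_skew X Y : cov_endo Dg A X Y = - cov_endo Dg A Y X.
Proof.
apply/eqP; rewrite -addr_eq0; have := NK (X + Y).
by rewrite cov_endoDl !cov_endo_addr !NK add0r addr0 => ->.
Qed.

Lemma torsion3_nk_connection X Y Z :
  torsion3 g nk_connection X Y Z = - g (cov_endo Dg A X Y) Z.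
Proof.
have [Tg0 _] := LC.
have bE : g (bracket X Y) Z = g (Dg X Y) Z - g (Dg Y X) Z.
  by rewrite (bracket_torsion Dg) Tg0 subr0 metricDl metricNl.
have expand a b c : g (a - b - c) Z = g a Z - g b Z - g c Z.
  by rewrite !metricE.
rewrite /torsion3 /torsion expand bE !metric_nk_connection.
rewrite (nearly_kahler_skew Y X) metricNl.
apply: smoothP => p; rewrite !smoothE; lra.
Qed.

Lemma skew_torsion_nk_connection : skew_torsion g nk_connection.
Proof.
have [_ Dg0] := LC => X Y Z.
by rewrite !torsion3_nk_connection (cov_endo_skew gA Dg0).
Qed.

(** With [P(X,Y) = (Dg_X A)Y], parallelism of [g] gives
[(Dg_X G)(Y,Z) = g(P(X,Y),Z)].  Passing to the new connection adds
[(G(P(X,Y),Z) + G(Y,P(X,Z))) / 2 = g(A P(X,Y),Z)], because [P(X,.)] is skew and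
anticommutes with [A].  The sum is [G(P(X,Y),Z)], that is [- G(T(X,Y),Z)]. *)
Lemma einstein_nk_connection :
  einstein_metricity (gen_metric g A) nk_connection.
Proof.
have [_ Dg0] := LC => X Y Z.
have covF : cov_bil Dg (kahler_form g A) X Y Z = g (cov_endo Dg A X Y) Z.
  by rewrite cov_kahler_endo Dg0 add0r.
have covg := Dg0 X Y Z.
have skZ : g Y (cov_endo Dg A X Z) = - g (cov_endo Dg A X Y) Z.
  by rewrite Defs.metric_sym (cov_endo_skew gA Dg0).
have skAZ : g (A Y) (cov_endo Dg A X Z) = - g (cov_endo Dg A X Y) (A Z).
  rewrite Defs.metric_sym (cov_endo_skew gA Dg0) (cov_endo_anticomm gA).
  by rewrite metricNl (hermitian_skew gA) opprK.
rewrite /gen_metric /kahler_form !(hermitian_skew gA (torsion _ _ _)).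
rewrite -!/(torsion3 g nk_connection _ _ _) !torsion3_nk_connection.
rewrite /cov_bil (hermitian_skew gA (nk_connection X Y)).
rewrite !(Defs.metric_sym _ _ (nk_connection X Z)) !metric_nk_connection.
rewrite !(Defs.metric_sym _ (cov_endo Dg A X Z)) skZ skAZ.
rewrite !(Defs.metric_sym _ (Dg X Z)) vf_derivD.
move: covF covg; rewrite /cov_bil /kahler_form (hermitian_skew gA (Dg X Y)).
move=> covF covg; apply: smoothP => p.
have := smooth_at p covF; have := smooth_at p covg.
rewrite !smoothE; lra.
Qed.

End NearlyKahlerConnection.

(** * The equivalence *)

(** From [Dg = D - T/2] and [g((D_X A)Y,Z) = T(X,Y,AZ) - T(X,Y,Z)] one gets
[g((Dg_X A)Y,Z) = - T(X,Y,Z)], since [A] can change slot; it vanishes on the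
diagonal [X = Y]. *)
Lemma einstein_nearly_kahler (R : realType) (n : nat) (M : manifold R n)
    (g : metric M) (A : {linear 'VF M -> 'VF M}) (Dg D : connection M) :
  almost_hermitian g A -> levi_civita g Dg ->
  einstein_metricity (gen_metric g A) D -> skew_torsion g D ->
  nearly_kahler Dg A.
Proof.
move=> gA LC einsteinD skewD X.
have Dg0 := einstein_metric_parallel gA einsteinD skewD.
apply: (@metric_nondegenerate _ _ _ g) => Z; rewrite metric0l.
have DgE Y W : g (Dg X Y) W = g (D X Y) W - (2^-1 : R) *: torsion3 g D X Y W.
  by rewrite (metric_connection_skew_torsion LC Dg0 skewD) addrK.
have covD := einstein_cov_endo gA einsteinD skewD X X Z.
have TXX W : torsion3 g D X X W = 0.
  apply: smoothP => p; have := smooth_at p (torsion3C g D X X W).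
  rewrite !smoothE; lra.
move: covD; rewrite /cov_endo !metricDl !metricNl !(hermitian_skew gA) !DgE.
rewrite (torsion3_A_shift gA einsteinD skewD) !TXX => covD.
apply: smoothP => p; have := smooth_at p covD.
rewrite !smoothE; lra.
Qed.

Theorem theorem3p2 (R : realType) (m : nat) (m_ge2 : (2 <= m)%N)
    (M : manifold R (2 * m)) (g : metric M) (A : {linear 'VF M -> 'VF M})
    (gA : almost_hermitian g A) (Dg : connection M) (LC : levi_civita g Dg) :
  let F := kahler_form g A in
  let G := gen_metric g A in
  let dF := ext_d F in
  let N := nijenhuis3 g A in
  let admissible (D : connection M) :=
    einstein_metricity G D /\ skew_torsion g D in
  [/\ (exists D, admissible D) <-> nearly_kahler Dg A,
      forall D D', admissible D -> admissible D' -> forall X Y, D X Y = D' X Y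
    & forall D, admissible D ->
      [/\ forall X Y Z,
            torsion3 g D X Y Z = - (3^-1 : R) *: dF X Y Z /\
            torsion3 g D X Y Z = (4^-1 : R) *: N X Y (A Z),
          forall X Y Z,
            g (D X Y) Z = g (Dg X Y) Z - (6^-1 : R) *: dF X Y Z /\
            g (D X Y) Z = g (Dg X Y) Z + (8^-1 : R) *: N X Y (A Z),
          forall X Y Z,
            cov_bil D G X Y Z = (3^-1 : R) *: (dF X Y Z - dF X Y (A Z)),
          forall X Y Z, cov_bil D g X Y Z = 0
        & forall X Y Z,
            cov_bil D F X Y Z = (3^-1 : R) *: (dF X Y Z - dF X Y (A Z))]].
Proof.
move=> F G dF N admissible.
have dFE D : admissible D -> forall X Y Z,
    dF X Y Z = - (3 : R) *: torsion3 g D X Y Z.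
  by case=> *; exact: einstein_ext_d.
have NE D : admissible D -> forall X Y Z,
    N X Y (A Z) = (4 : R) *: torsion3 g D X Y Z.
  case=> einsteinD skewD X Y Z; rewrite /N (einstein_nijenhuis gA einsteinD) //.
  by rewrite (torsion3_AA gA) scalerN scaleNr opprK.
have DE D : admissible D -> forall X Y Z,
    g (D X Y) Z = g (Dg X Y) Z + (2^-1 : R) *: torsion3 g D X Y Z.
  case=> einsteinD skewD; apply: metric_connection_skew_torsion => //.
  exact: (einstein_metric_parallel gA einsteinD skewD).
have DdF D : admissible D -> forall X Y Z,
    g (D X Y) Z = g (Dg X Y) Z - (6^-1 : R) *: dF X Y Z.
  move=> aD X Y Z; rewrite (DE D aD) (dFE D aD).
  by apply: smoothP => p; rewrite !smoothE; lra.
split.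
- split=> [[D [einsteinD skewD]]|NK].
    exact: (einstein_nearly_kahler gA LC einsteinD skewD).
  exists (nk_connection A Dg).
  split; [exact: einstein_nk_connection|exact: skew_torsion_nk_connection].
- move=> D D' aD aD' X Y; apply: (@metric_nondegenerate _ _ _ g) => Z.
  by rewrite (DdF D aD) (DdF D' aD').
- move=> D aD; have [einsteinD skewD] := aD.
  have cg0 := einstein_metric_parallel gA einsteinD skewD.
  have cF X Y Z : cov_bil D F X Y Z = (3^-1 : R) *: (dF X Y Z - dF X Y (A Z)).
    rewrite (einstein_cov_kahler gA einsteinD skewD) !(dFE D aD).
    by apply: smoothP => p; rewrite !smoothE; lra.
  split=> // X Y Z.
  + rewrite (dFE D aD) (NE D aD).
    by split; apply: smoothP => p; rewrite !smoothE; lra.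
  + split; first exact: DdF.
    rewrite (DE D aD) (NE D aD).
    by apply: smoothP => p; rewrite !smoothE; lra.
  + by rewrite cov_bil_gen_metric cg0 add0r; exact: cF.
Qed.
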